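(* Let $X_1\sim F_1$, $X_2\sim F_2$ be two nonnegative, continuous, strictly DGMRD demand distributions with finite second moment. For $i=1,2$ let $L_i$ be the lower end of the support of $X_i$ and $r_i^*$ the supplier's optimal wholesale price in market $X_i$. (i) If either $X_1$ or $X_2$ is DMRD, $X_1\preceq_{\mathrm{ew}}X_2$, and $L_1\le L_2$, then $r_1^*\le r_2^*$. (ii) If either $X_1$ or $X_2$ is IFR and $X_1\preceq_{\mathrm{disp}}X_2$, then $r_1^*\le r_2^*$.
   Context: For a nonnegative random variable $X$ with continuous (non-atomic) cdf $F$, $F(0)=0$, finite mean, $\bar F:=1-F$ and $H=\inf\{r\ge0:F(r)=1\}\in(0,\infty]$, the mean residual demand (MRD) function is $\mathrm{m}(r):=\mathbb{E}(X-r\mid X>r)=\frac{1}{\bar F(r)}\int_r^\infty\bar F(u)\,du$ for $r<H$ and $\mathrm{m}(r):=0$ otherwise. $X$ is DMRD if $\mathrm{m}$ is non-increasing; (strictly) DGMRD if $\ell(r):=\mathrm{m}(r)/r$ is (strictly) decreasing on $(0,H)$; IFR if it has increasing failure rate (i.e. $\bar F$ is log-concave). The lower end of the support is $L=\sup\{r\ge0:F(r)=0\}$. The supplier's optimal wholesale price is the maximizer $r^*$ of $r\,\mathbb{E}(X-r)_+$ over $r\ge0$, where $(x)_+=\max\{0,x\}$; for strictly DGMRD $X$ with finite second moment it exists and is the unique solution of $r=\mathrm{m}(r)$. Variability orders: let $X_1\sim F_1$, $X_2\sim F_2$ be nonnegative with equal means $\mathbb{E}X_1=\mathbb{E}X_2$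 and finite second moments, and let $F_1^{-1},F_2^{-1}$ be the right-continuous inverses of $F_1,F_2$. Then $X_1\preceq_{\mathrm{disp}}X_2$ (dispersive order) if $F_1^{-1}(s)-F_1^{-1}(r)\le F_2^{-1}(s)-F_2^{-1}(r)$ for all $0<r\le s<1$; and $X_1\preceq_{\mathrm{ew}}X_2$ (excess wealth order) if $\int_{F_1^{-1}(p)}^\infty\bar F_1(u)\,du\le\int_{F_2^{-1}(p)}^\infty\bar F_2(u)\,du$ for all $p\in(0,1)$. *)

(* Defs.v *)
From HB Require Import structures.
From mathcomp Require Import all_boot all_order all_algebra.
From mathcomp Require Import all_classical all_reals all_analysis.

Set Implicit Arguments.
Unset Strict Implicit.
Unset Printing Implicit Defensive.

Import Order.TTheory GRing.Theory Num.Theory.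
Import numFieldNormedType.Exports.

Local Open Scope classical_set_scope.
Local Open Scope ring_scope.

Section demand.
Context {R : realType} {d : measure_display} {T : measurableType d}
  {P : probability T R}.
Implicit Types (X : {RV P >-> R}).

Definition rcdf X (r : R) : R := fine (cdf X r).

Definition survival X (r : R) : R := 1 - rcdf X r.

(* Nonnegativity is almost sure, so that it only depends on the distribution. *)
Definition nonneg_continuous_demand X : Prop :=
  [/\ {ae P, forall w, 0 <= X w},
      continuous (rcdf X),
      rcdf X 0 = 0 &
      (X : T -> R) \in Lfun P 1%E].

Definition finite_second_moment X : Prop :=
  ('E_P[fun w => (X w ^+ 2)%R] < +oo)%E.

(* [ereal_inf] of the empty set is +oo. *)
Definition support_sup X : \bar R :=
  ereal_inf [set r%:E | r in [set r : R | 0 <= r /\ rcdf X r = 1]].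

Definition support_inf X : R := sup [set r : R | 0 <= r /\ rcdf X r = 0].

Definition tail_integral X (r : R) : \bar R :=
  (\int[lebesgue_measure]_(u in `[r, +oo[) (survival X u)%:E)%E.

(* E(X - r | X > r), computed from the survival function; the integral is
   finite because X has a finite mean. *)
Definition mrd X (r : R) : R :=
  if (r%:E < support_sup X)%E then fine (tail_integral X r) / survival X r
  else 0.

Definition DMRD X : Prop :=
  forall r s : R, 0 <= r -> r <= s -> mrd X s <= mrd X r.

Definition strictly_DGMRD X : Prop :=
  forall r s : R, 0 < r -> r < s -> (s%:E < support_sup X)%E ->
    mrd X s / s < mrd X r / r.

(* Log-concavity in multiplicative form, as survival may vanish; note that
   [0 `^ 0 = 1] and [0 `^ t = 0] for [t != 0]. *)
Definition IFR X : Prop :=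
  forall x y t : R, 0 <= t -> t <= 1 ->
    survival X x `^ t * survival X y `^ (1 - t) <=
      survival X (t * x + (1 - t) * y).

Definition supplier_revenue X (r : R) : \bar R :=
  (r%:E * 'E_P[fun w => (Num.max 0 (X w - r))%R])%E.

Definition optimal_price X (r : R) : Prop :=
  0 <= r /\
  forall s : R, 0 <= s -> (supplier_revenue X s <= supplier_revenue X r)%E.

(* Right-continuous inverse: the strict inequality [p < rcdf X x] makes it so. *)
Definition Finv X (p : R) : R := inf [set x : R | p < rcdf X x].

End demand.

Section variability_orders.
Context {R : realType} {d1 d2 : measure_display}
  {T1 : measurableType d1} {T2 : measurableType d2}
  {P1 : probability T1 R} {P2 : probability T2 R}.
Context (X1 : {RV P1 >-> R}) (X2 : {RV P2 >-> R}).

Definition disp_order : Prop :=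
  forall r s : R, 0 < r -> r <= s -> s < 1 ->
    Finv X1 s - Finv X1 r <= Finv X2 s - Finv X2 r.

Definition ew_order : Prop :=
  forall p : R, 0 < p -> p < 1 ->
    (tail_integral X1 (Finv X1 p) <= tail_integral X2 (Finv X2 p))%E.

End variability_orders.

(* Main.v *)
Require Import Defs.
From HB Require Import structures.
From mathcomp Require Import all_boot all_order all_algebra.
From mathcomp Require Import all_classical all_reals all_analysis.
From mathcomp Require Import measurable_realfun.
From mathcomp Require Import ring lra.

Import Order.TTheory GRing.Theory Num.Theory.
Import numFieldNormedType.Exports.

Local Open Scope classical_set_scope.
Local Open Scope ring_scope.

(** Write [G_i r = E(X_i - r)_+] for the integral of the survival function over
    [r, +oo[. Where [F_2 a < F_1 a], a level [p] strictly between the two values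
    has quantiles on either side of [a], so the excess wealth order gives
    [G_1 a <= G_2 a]; elsewhere [G_2 - G_1] is nondecreasing, and it vanishes at
    0 since the means agree. Hence [G_1 <= G_2] everywhere. The same
    levels [p], combined with the monotonicity of one of the mean residual
    demands between [r] and the corresponding quantile, give [m_1 r <= m_2 r].
    At the optimal prices [m_i r_i = r_i], so if [r_2 < r_1] then
    [m_2 r_1 / r_1 >= 1 = m_2 r_2 / r_2], against strict DGMRD. Part (ii) reduces
    to part (i): IFR implies DMRD and the dispersive order implies the excess
    wealth order, both by integrating a pointwise inequality between translated
    survival functions. *)

(** * Translation of Lebesgue integrals over half-lines *)

Lemma measurable_translation {R : realType} (r : R) :
  measurable_fun setT ((fun x => r + x) : measurableTypeR R -> measurableTypeR R).
Proof. by apply: measurable_funD; [exact: measurable_cst|exact: measurable_id]. Qed.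

Lemma lebesgue_measure_translation {R : realType} (r : R) (A : set R) :
  measurable A ->
  pushforward lebesgue_measure ((fun x => r + x) : _ -> measurableTypeR R) A =
  lebesgue_measure A.
Proof.
move=> mA; apply/esym/lebesgue_measure_unique; last exact: mA.
  exact: measurable_translation.
move=> mr _ [[a b]] _ <-; rewrite /= /pushforward.
have -> : (fun x => r + x) @^-1` `]a, b] = `](a - r), (b - r)]%classic.
  by apply/seteqP; split => x /=; rewrite !in_itv/= ltrBlDl lerBrDl.
rewrite !lebesgue_measure_itv/= !lte_fin ltrD2r.
by case: ifP => // _; rewrite -!EFinB; congr EFin; ring.
Qed.

Lemma ge0_integral_translation {R : realType} (r : R) (f : R -> \bar R) :
  measurable_fun setT f -> (forall x, (0 <= f x)%E) ->
  (\int[lebesgue_measure]_(u in `[r, +oo[) f u =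
   \int[lebesgue_measure]_(t in `[0%R, +oo[) f (r + t)%R)%E.
Proof.
move=> mf f0.
rewrite (_ : `[0, +oo[%classic =
    ((fun x => r + x) : _ -> measurableTypeR R) @^-1` `[r, +oo[); last first.
  by apply/seteqP; split => x /=; rewrite !in_itv/= !andbT lerDl.
rewrite -(ge0_integral_pushforward (measurable_translation r))//=.
- apply: eq_measure_integral; first exact: measurable_translation.
  by move=> mr A mA _; exact/esym/lebesgue_measure_translation.
- exact: measurable_funS mf.
Qed.

Lemma integral_cst_itv {R : realType} (a b c : R) : a <= b ->
  (\int[lebesgue_measure]_(u in `[a, b[) (cst c%:E u) = ((b - a) * c)%:E)%E.
Proof.
move=> ab; rewrite integral_cst//= lebesgue_measure_itv/= lte_fin.
move: ab; rewrite le_eqVlt => /predU1P[->|->].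
  by rewrite ltxx subrr mul0r mule0.
by rewrite -EFinB -EFinM mulrC.
Qed.

(** * Survival functions and comparison of their tail integrals *)

Section survival.
Context {R : realType} {d : measure_display} {T : measurableType d}
  {P : probability T R}.
Implicit Types (X : {RV P >-> R}).

Lemma rcdf_nondecreasing X : {homo rcdf X : r s / r <= s}.
Proof.
by move=> r s rs; rewrite fine_le ?fin_num_measure// cdf_nondecreasing.
Qed.

Lemma survival_nonincreasing X : {homo survival X : r s / r <= s >-> s <= r}.
Proof. by move=> r s rs; rewrite lerB// rcdf_nondecreasing. Qed.

Lemma survival_ccdf X r : (survival X r)%:E = ccdf X r.
Proof.
by rewrite ccdf_1_cdf EFinB fineK// fin_num_measure.
Qed.

Lemma survival_ge0 X r : 0 <= survival X r.
Proof. by rewrite -lee_fin survival_ccdf. Qed.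

Lemma measurable_survival X (D : set R) :
  measurable_fun D (fun u => (survival X u)%:E).
Proof.
apply/measurable_funTS; under eq_fun do rewrite survival_ccdf.
exact: ccdf_measurable.
Qed.

Lemma tail_integral_translation X r :
  tail_integral X r =
  (\int[lebesgue_measure]_(t in `[0%R, +oo[) (survival X (r + t)%R)%:E)%E.
Proof.
rewrite /tail_integral; apply: ge0_integral_translation.
  exact: measurable_survival.
by move=> u; rewrite lee_fin survival_ge0.
Qed.

Lemma measurable_survival_translation X r (D : set R) :
  measurable_fun D (fun t => (survival X (r + t))%:E).
Proof.
apply: measurable_funTS.
exact: measurableT_comp (measurable_survival X setT) (measurable_translation r).
Qed.

End survival.

(** Moving both integrals to [[0, +oo[] lets survival functions be compared at different base
    points. The weights serve for IFR, and equal 1 for the dispersive order. *)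
Lemma le_tail_integral {R : realType} {d1 d2 : measure_display}
    {T1 : measurableType d1} {T2 : measurableType d2}
    {P1 : probability T1 R} {P2 : probability T2 R}
    (X1 : {RV P1 >-> R}) (X2 : {RV P2 >-> R}) (c1 c2 r1 r2 : R) :
  0 <= c1 -> 0 <= c2 ->
  (forall t, 0 <= t ->
    c1 * survival X1 (r1 + t) <= c2 * survival X2 (r2 + t)) ->
  (c1%:E * tail_integral X1 r1 <= c2%:E * tail_integral X2 r2)%E.
Proof.
move=> c10 c20 le12; rewrite !tail_integral_translation.
rewrite -!ge0_integralZl_EFin//=.
- apply: ge0_le_integral => //=.
  + by move=> t _; rewrite mule_ge0 ?lee_fin ?survival_ge0.
  + by apply: measurable_funeM; exact: measurable_survival_translation.
  + by apply: measurable_funeM; exact: measurable_survival_translation.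
  + by move=> t; rewrite in_itv/= andbT -!EFinM lee_fin; exact: le12.
- by move=> t _; rewrite lee_fin survival_ge0.
- exact: measurable_survival_translation.
- by move=> t _; rewrite lee_fin survival_ge0.
- exact: measurable_survival_translation.
Qed.

(** * Expected excess demand as a tail integral *)

Section demand.
Context {R : realType} {d : measure_display} {T : measurableType d}
  {P : probability T R}.
Implicit Types (X : {RV P >-> R}).

Lemma measurable_excess X r :
  measurable_fun setT (fun w => Num.max 0 (X w - r)).
Proof.
apply: measurable_maxr; first exact: measurable_cst.
by apply: measurable_funB; [exact: measurable_funPT|exact: measurable_cst].
Qed.

(** Layer-cake formula: for [0 <= t] the excess is above [t] exactly when [X] is above [r + t]. *)
Lemma expectation_excess X r :
  ('E_P[fun w => (Num.max 0 (X w - r))%R] = tail_integral X r)%E.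
Proof.
have mY := measurable_excess X r.
pose Y : {RV P >-> R} := HB.pack_for {mfun T >-> R}
  (fun w => Num.max 0 (X w - r)) (isMeasurableFun.Build _ _ _ _ _ mY).
have /= -> := @ge0_expectation_ccdf _ _ _ _ Y.
  rewrite tail_integral_translation; apply: eq_integral => t.
  rewrite inE/= in_itv/= andbT => t0.
  rewrite survival_ccdf /ccdf /distribution/= /pushforward; congr (P _).
  apply/seteqP; split=> w /=; rewrite !in_itv/= !andbT lt_max ltNge t0/=;
  by rewrite ltrBrDl.
by move=> w; rewrite /= le_max lexx.
Qed.

Lemma rcdf_ge0 X r : 0 <= rcdf X r.
Proof. by rewrite fine_ge0// cdf_ge0. Qed.

Lemma survival_le1 X r : survival X r <= 1.
Proof. by rewrite gerBl rcdf_ge0. Qed.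

Lemma rcdf_le1 X r : rcdf X r <= 1.
Proof. by rewrite -subr_ge0; exact: survival_ge0. Qed.

Lemma rcdf_gt_ex X (p : R) : p < 1 -> exists x, p < rcdf X x.
Proof.
move=> p1; have /fine_cvgP[_ F1] := cvg_cdfy1 X.
exact: filter_ex (cvgr_gt _ F1 _ p1).
Qed.

Definition tail X (r : R) : R := fine (tail_integral X r).

Lemma tail_integral_ge0 X r : (0 <= tail_integral X r)%E.
Proof. by apply: integral_ge0 => u _; rewrite lee_fin survival_ge0. Qed.

Lemma tail_ge0 X r : 0 <= tail X r.
Proof. by rewrite fine_ge0// tail_integral_ge0. Qed.

Lemma tail_integral_setU X a b : a <= b ->
  (tail_integral X a =
   \int[lebesgue_measure]_(u in `[a, b[) (survival X u)%:E +
   tail_integral X b)%E.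
Proof.
move=> ab; rewrite /tail_integral -ge0_integral_setU//=.
- by rewrite -itv_bndbnd_setU// bnd_simp.
- exact: measurable_survival.
- by move=> u _; rewrite lee_fin survival_ge0.
- apply/disj_setPS => u [/=]; rewrite !in_itv/= andbT => /andP[_ ub].
  by rewrite leNgt ub.
Qed.

Section continuous_demand.
Context {X : {RV P >-> R}} (demand : nonneg_continuous_demand X).

Lemma expectation_tail_integral : 'E_P[X]%E = tail_integral X 0.
Proof.
have [X0 _ _ _] := demand.
rewrite -expectation_excess unlock; apply: ae_eq_integral => //.
- exact/measurable_EFinP/measurable_funPT.
- exact/measurable_EFinP/measurable_excess.
- by apply: filterS X0 => w w0 _; rewrite subr0 max_r.
Qed.

Lemma tail_integral_fin_num r : 0 <= r -> tail_integral X r \is a fin_num.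
Proof.
have [_ _ _ X1] := demand.
move=> r0; rewrite ge0_fin_numE ?tail_integral_ge0//.
apply: (@le_lt_trans _ _ (tail_integral X 0)).
  rewrite (tail_integral_setU _ _ _ r0) leeDr//.
  by apply: integral_ge0 => u _; rewrite lee_fin survival_ge0.
by rewrite -expectation_tail_integral ltey_eq expectation_fin_num.
Qed.

Lemma tailE r : 0 <= r -> (tail X r)%:E = tail_integral X r.
Proof. by move=> r0; rewrite fineK// tail_integral_fin_num. Qed.

Lemma integral_survival a b : 0 <= a -> a <= b ->
  (\int[lebesgue_measure]_(u in `[a, b[) (survival X u)%:E =
   (tail X a - tail X b)%:E)%E.
Proof.
move=> a0 ab; have b0 := le_trans a0 ab.
by rewrite EFinB !tailE// (tail_integral_setU _ _ _ ab) addeK ?tail_integral_fin_num.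
Qed.

Lemma tail_le a b : 0 <= a -> a <= b ->
  tail X a <= tail X b + (b - a) * survival X a.
Proof.
move=> a0 ab; rewrite -lerBlDl -lee_fin -integral_survival// -integral_cst_itv//.
apply: ge0_le_integral => //=.
- by move=> u _; rewrite lee_fin survival_ge0.
- exact: measurable_survival.
- move=> u; rewrite in_itv/= => /andP[au _].
  by rewrite lee_fin survival_nonincreasing.
Qed.

Lemma tail_ge a b : 0 <= a -> a <= b ->
  tail X b + (b - a) * survival X b <= tail X a.
Proof.
move=> a0 ab; rewrite -lerBrDl -lee_fin -integral_survival// -integral_cst_itv//.
apply: ge0_le_integral => //=.
- by move=> u _; rewrite lee_fin survival_ge0.
- exact: measurable_survival.
- move=> u; rewrite in_itv/= => /andP[_ ub].
  by rewrite lee_fin survival_nonincreasing// ltW.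
Qed.

Lemma tail_nonincreasing a b : 0 <= a -> a <= b -> tail X b <= tail X a.
Proof.
move=> a0 ab; apply: le_trans (tail_ge _ _ a0 ab).
by rewrite lerDl; apply: mulr_ge0; [rewrite subr_ge0|exact: survival_ge0].
Qed.

Lemma rcdf1_tail0 r : 0 <= r -> rcdf X r = 1 -> tail X r = 0.
Proof.
move=> r0 Fr; apply/EFin_inj; rewrite tailE//; apply: integral0_eq => u /=.
rewrite in_itv/= andbT => ru; congr EFin; apply/le_anti.
rewrite survival_ge0 andbT (le_trans (survival_nonincreasing _ _ _ ru))//.
by rewrite /survival Fr subrr.
Qed.

Lemma survival_gt0 r : 0 <= r -> 0 < tail X r -> 0 < survival X r.
Proof.
move=> r0 t0; rewrite lt_neqAle survival_ge0 andbT eq_sym.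
apply: contraTneq t0 => /subr0_eq/esym Fr.
by rewrite rcdf1_tail0// ltxx.
Qed.

Lemma lt_support_sup r : 0 <= r -> (r%:E < support_sup X)%E = (rcdf X r < 1).
Proof.
have [_ cF _ _] := demand.
move=> r0; apply/idP/idP.
  apply: contraTT; rewrite -!leNgt => F1; apply: ereal_inf_lbound.
  by exists r => //; split => //; apply/le_anti; rewrite F1 rcdf_le1.
(* By continuity the cdf is still below 1 at [r + e / 2], so the infimum exceeds [r] by at least
   [e / 2]; this makes the inequality strict. *)
move=> F1; have /cvgr_lt/(_ _ F1) := cF r.
move=> [e /= e0 re]; have {}re := re (r + e / 2).
apply: (@lt_le_trans _ _ (r + e / 2)%:E).
  by rewrite lte_fin ltrDl divr_gt0.
apply: le_ereal_inf_tmp => _ [s [s0 Fs] <-]; rewrite lee_fin leNgt.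
apply/negP => sr; have: rcdf X (r + e / 2) < 1.
  apply: re => /=; rewrite opprD addrA subrr add0r normrN gtr0_norm; lra.
by rewrite ltNge -[leLHS]Fs rcdf_nondecreasing// ltW.
Qed.

(* The convention [x / 0 = 0] makes this hold beyond the support too. *)
Lemma mrdE r : 0 <= r -> mrd X r = tail X r / survival X r.
Proof.
move=> r0; rewrite /mrd lt_support_sup//; case: ltP => // F1.
by rewrite rcdf1_tail0 ?mul0r//; apply/le_anti; rewrite F1 rcdf_le1.
Qed.

(** * Quantiles of a continuous cdf *)

Let Finv_set_bounded p : 0 < p -> lbound [set x | p < rcdf X x] 0.
Proof.
have [_ _ F0 _] := demand.
move=> p0 x /= px; rewrite leNgt; apply: contraTN px => x0.
rewrite -leNgt (le_trans _ (ltW p0))// -F0.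
by apply: rcdf_nondecreasing; rewrite ltW.
Qed.

Lemma Finv_le p a : 0 < p -> p < rcdf X a -> Finv X p <= a.
Proof.
by move=> p0 pa; apply: inf_lbound => //; exists 0; exact: Finv_set_bounded.
Qed.

Lemma Finv_ge p a : p < 1 -> rcdf X a <= p -> a <= Finv X p.
Proof.
move=> p1 ap; apply: lb_le_inf; first exact: rcdf_gt_ex.
move=> x /= px; rewrite leNgt; apply/negP => xa.
have := rcdf_nondecreasing X _ _ (ltW xa).
by rewrite leNgt (le_lt_trans ap).
Qed.

Lemma Finv_ge0 p : 0 < p -> p < 1 -> 0 <= Finv X p.
Proof.
by have [_ _ F0 _] := demand; move=> p0 p1; rewrite Finv_ge// F0 ltW.
Qed.

(** If the cdf at the quantile were above or below [p], continuity would keep it so at distance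
    [e / 2] to the left or to the right, against the definition as an infimum. *)
Lemma rcdf_Finv p : 0 < p -> p < 1 -> rcdf X (Finv X p) = p.
Proof.
have [_ cF _ _] := demand.
move=> p0 p1; apply/le_anti/andP; split.
- rewrite leNgt; apply/negP => pF.
  have /cvgr_gt/(_ _ pF) := cF (Finv X p).
  move=> [e /= e0 re]; have {}re := re (Finv X p - e / 2).
  have: Finv X p <= Finv X p - e / 2.
    apply: Finv_le => //; apply: re => /=.
    by rewrite opprB addrC subrK gtr0_norm; lra.
  by lra.
- rewrite leNgt; apply/negP => Fp.
  have /cvgr_lt/(_ _ Fp) := cF (Finv X p).
  move=> [e /= e0 re]; have {}re := re (Finv X p + e / 2).
  have: Finv X p + e / 2 <= Finv X p.
    apply: Finv_ge => //; apply: ltW; apply: re => /=.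
    by rewrite opprD addrA subrr add0r normrN gtr0_norm; lra.
  by lra.
Qed.

Lemma survival_Finv p : 0 < p -> p < 1 -> survival X (Finv X p) = 1 - p.
Proof. by move=> p0 p1; rewrite /survival rcdf_Finv. Qed.

(** * Positivity and first-order conditions at an optimal price *)

Lemma tail_gt0_ex : exists2 r, 0 < r & 0 < tail X r.
Proof.
have [_ cF F0 _] := demand.
have F1 : rcdf X 0 < 1 by rewrite F0.
have /cvgr_lt/(_ _ F1) := cF 0.
move=> [e /= e0 re]; exists (e / 4); first by lra.
have e4 : 0 <= e / 4 by lra.
have e42 : e / 4 <= e / 2 by lra.
apply: lt_le_trans (tail_ge _ _ e4 e42).
rewrite ltr_wpDl ?tail_ge0// mulr_gt0//; first by lra.
by rewrite subr_gt0; apply: re => /=; rewrite sub0r normrN gtr0_norm; lra.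
Qed.

Lemma optimal_priceP r : optimal_price X r <->
  0 <= r /\ forall s, 0 <= s -> s * tail X s <= r * tail X r.
Proof.
split=> -[r0 opt]; split=> // s s0; have := opt s s0;
by rewrite /supplier_revenue !expectation_excess -!tailE// -!EFinM lee_fin.
Qed.

Lemma optimal_price_gt0 r : optimal_price X r -> 0 < r /\ 0 < tail X r.
Proof.
move=> /optimal_priceP[r0 opt]; have [s s0 ts] := tail_gt0_ex.
have : 0 < r * tail X r by rewrite (lt_le_trans _ (opt s (ltW s0)))// mulr_gt0.
move=> rt; split; rewrite lt_neqAle ?r0 ?tail_ge0 andbT; apply: contraTneq rt => <-.
  by rewrite mul0r ltxx.
by rewrite mulr0 ltxx.
Qed.

(** One half of the first-order condition: otherwise a slightly lower price [r - h] would earn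
    more. *)
Lemma optimal_price_le_mrd r : optimal_price X r ->
  r * survival X r <= tail X r.
Proof.
move=> ropt; have [r0 t0] := optimal_price_gt0 _ ropt.
have /optimal_priceP[_ opt] := ropt.
have S0 := survival_gt0 _ (ltW r0) t0.
rewrite leNgt; apply/negP => tS; set S := survival X r in S0 tS *.
(* Revenue at [r - h] exceeds that at [r] by at least [h * (r * S - tail X r - h * S)]; this [h]
   makes [h * S] half of the gap [r * S - tail X r]. *)
pose h := (r * S - tail X r) / (2 * S).
have hS : h * S = (r * S - tail X r) / 2 by rewrite /h; field; lra.
have h0 : 0 < h by rewrite divr_gt0//; lra.
have hr : h < r by rewrite -(ltr_pM2r S0); lra.
have rh0 : 0 <= r - h by lra.
have th : tail X r + h * S <= tail X (r - h).
  by have := tail_ge (r - h) r rh0; rewrite subKr; apply; lra.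
have := opt _ rh0.
have : (r - h) * (tail X r + h * S) <= (r - h) * tail X (r - h).
  by rewrite ler_wpM2l.
nra.
Qed.

(** The other half: otherwise a slightly higher price [r + h] would earn more. *)
Lemma optimal_price_ge_mrd r : optimal_price X r ->
  tail X r <= r * survival X r.
Proof.
move=> ropt; have [r0 t0] := optimal_price_gt0 _ ropt.
have /optimal_priceP[_ opt] := ropt.
rewrite leNgt; apply/negP => tS; have S1 := survival_le1 X r.
have S0 := survival_ge0 X r; set S := survival X r in S0 S1 tS *.
(* The gain is at least [h * (tail X r - r * S - h * S)], and [S <= 1] bounds [h * S] by [h], half
   of the gap. *)
pose h := (tail X r - r * S) / 2.
have h0 : 0 < h by rewrite /h; lra.
have rh0 : 0 <= r + h by lra.
have th : tail X r <= tail X (r + h) + h * S.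
  have := tail_le r (r + h) (ltW r0).
  by rewrite addrAC subrr add0r; apply; lra.
have := opt _ rh0.
have : (r + h) * (tail X r - h * S) <= (r + h) * tail X (r + h).
  by rewrite ler_wpM2l//; lra.
move=> le1 le2; have : h * tail X r <= h * ((r + h) * S) by lra.
rewrite ler_pM2l// => le3; have : h * S <= h by rewrite ler_piMr// ltW.
by move: le3; rewrite /h; lra.
Qed.

(* Log-concavity in its multiplicative form: [b] and [a + t] both lie
   between [a] and [b + t] and have the same sum. *)
Lemma IFR_survivalM a b t : IFR X -> a <= b -> 0 <= t ->
  survival X a * survival X (b + t) <= survival X b * survival X (a + t).
Proof.
move=> ifr ab t0.
(* Apart from this trivial case, survival is positive at both [a] and [b + t], so exponents add up
   when the two log-concavity inequalities are multiplied. *)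
have [tb0|tb0] := eqVneq (survival X (b + t)) 0.
  by rewrite tb0 mulr0 mulr_ge0// survival_ge0.
have tb : 0 < survival X (b + t) by rewrite lt_neqAle eq_sym tb0 survival_ge0.
have ta : 0 < survival X a.
  by rewrite (lt_le_trans tb)//; apply: survival_nonincreasing; lra.
move: (ab) (t0); rewrite le_eqVlt => /predU1P[-> _|ab' _]; first by rewrite lexx.
(* The weight [l] on [a] produces [b], and the swapped weight [1 - l] produces [a + t]. *)
pose l := t / (b + t - a).
have l0 : 0 <= l by rewrite divr_ge0//; lra.
have l1 : l <= 1 by rewrite ler_pdivrMr; lra.
have := ifr a (b + t) l l0 l1.
have -> : l * a + (1 - l) * (b + t) = b by rewrite /l; field; lra.
have l'0 : 0 <= 1 - l by lra.
have l'1 : 1 - l <= 1 by lra.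
have := ifr a (b + t) (1 - l) l'0 l'1.
have -> : (1 - l) * a + (1 - (1 - l)) * (b + t) = a + t by rewrite /l; field; lra.
rewrite subKr => h1 h2.
have := ler_pM (mulr_ge0 (powR_ge0 _ _) (powR_ge0 _ _))
  (mulr_ge0 (powR_ge0 _ _) (powR_ge0 _ _)) h2 h1.
rewrite mulrACA -!powRD ?(gt_eqF ta) ?(gt_eqF tb) ?implybT//.
by rewrite subrK addrC subrK !powRr1 ?survival_ge0.
Qed.

Lemma IFR_DMRD : IFR X -> DMRD X.
Proof.
move=> ifr a b a0 ab; have b0 := le_trans a0 ab.
rewrite !mrdE//.
have key : survival X a * tail X b <= survival X b * tail X a.
  rewrite -lee_fin !EFinM !tailE//; apply: le_tail_integral => [||t t0].
  - exact: survival_ge0.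
  - exact: survival_ge0.
  - exact: IFR_survivalM.
(* Here division by zero makes the left-hand side 0. *)
have [->|Sb] := eqVneq (survival X b) 0.
  by rewrite invr0 mulr0 divr_ge0 ?tail_ge0 ?survival_ge0.
have {}Sb : 0 < survival X b by rewrite lt_neqAle eq_sym Sb survival_ge0.
have Sa : 0 < survival X a by rewrite (lt_le_trans Sb)// survival_nonincreasing.
rewrite ler_pdivrMr// mulrAC ler_pdivlMr// mulrC (le_trans key)//.
by rewrite mulrC.
Qed.

End continuous_demand.
End demand.

(** The limit [t -> 0], used to push a quantile level [p], strictly between two cdf values, to one
    of them. *)
Lemma le_convex_comb {R : realFieldType} (x y c : R) :
  (forall t, 0 < t -> t < 1 -> (1 - t) * x + t * y <= c) -> x <= c.
Proof.
move=> le_c; rewrite leNgt; apply/negP => cx.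
have [cy|yc] := leP c y; first by have := le_c (1 / 2); lra.
(* With this [t] the combination is the midpoint of [x] and [c], still above [c]. *)
pose t := (x - c) / (2 * (x - y)).
have tE : t * (x - y) = (x - c) / 2 by rewrite /t; field; lra.
have t0 : 0 < t by rewrite divr_gt0//; lra.
have t1 : t < 1 by rewrite ltr_pdivrMr; lra.
by have := le_c t t0 t1; lra.
Qed.

(** * Comparison of tails and mean residual demands under the variability orders *)

Section comparison.
Context {R : realType} {d1 d2 : measure_display}
  {T1 : measurableType d1} {T2 : measurableType d2}
  {P1 : probability T1 R} {P2 : probability T2 R}
  {X1 : {RV P1 >-> R}} {X2 : {RV P2 >-> R}}
  (demand1 : nonneg_continuous_demand X1)
  (demand2 : nonneg_continuous_demand X2).

(** Past the [p]-quantiles, survival of [X1] is at most that of [X2] at each distance [t]. Otherwise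
    a level [s] between the two cdf values has its [X2] quantile within [t] of that of [p]; the
    order gives the same for [X1], contradicting the choice of [s]. *)
Lemma disp_ew_order : disp_order X1 X2 -> ew_order X1 X2.
Proof.
move=> disp p p0 p1; rewrite -[leLHS]mul1e -[leRHS]mul1e.
apply: le_tail_integral => // t t0; rewrite !mul1r lerD2l lerN2.
set x1 := Finv X1 p; set x2 := Finv X2 p.
have px : p <= rcdf X1 (x1 + t).
  by rewrite -[leLHS](rcdf_Finv demand1 p p0 p1) rcdf_nondecreasing// lerDl.
rewrite leNgt; apply/negP => lt21.
have [s /andP[s1 s2]] : exists s, rcdf X1 (x1 + t) < s < rcdf X2 (x2 + t).
  by exists ((rcdf X1 (x1 + t) + rcdf X2 (x2 + t)) / 2); lra.
have s0 : 0 < s by lra.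
have s_lt1 : s < 1.
  by rewrite (lt_le_trans s2)// rcdf_le1.
have h2 : Finv X2 s <= x2 + t by exact: Finv_le.
have h1 := disp p s p0 (le_trans px (ltW s1)) s_lt1.
have : rcdf X1 (Finv X1 s) <= rcdf X1 (x1 + t).
  by apply: rcdf_nondecreasing; rewrite /x1; lra.
by rewrite rcdf_Finv//; lra.
Qed.

Context (ew : ew_order X1 X2).

Lemma ew_order_tail_Finv a p : 0 <= a -> rcdf X2 a < p -> p < rcdf X1 a ->
  [/\ 0 < p, p < 1, 0 <= Finv X1 p <= a, a <= Finv X2 p &
  tail X1 (Finv X1 p) <= tail X2 (Finv X2 p)].
Proof.
move=> a0 F2p pF1.
have p0 : 0 < p by rewrite (le_lt_trans _ F2p)// rcdf_ge0.
have p1 : p < 1 by rewrite (lt_le_trans pF1)// rcdf_le1.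
have x1 := Finv_ge0 demand1 p p0 p1; have x2 := Finv_ge0 demand2 p p0 p1.
have x1a := Finv_le demand1 p a p0 pF1.
have ax2 := Finv_ge p a p1 (ltW F2p).
split => //; [exact/andP|by rewrite -lee_fin !tailE//; exact: ew].
Qed.

(** Tails are nonincreasing and [a] lies between the two quantiles of a level [p], here the midpoint
    of the two cdf values. *)
Lemma ew_order_le_tail_lt a : 0 <= a -> rcdf X2 a < rcdf X1 a ->
  tail X1 a <= tail X2 a.
Proof.
move=> a0 F21.
have [p0 p1 /andP[x1 x1a] ax2 le12] := ew_order_tail_Finv a
  ((rcdf X2 a + rcdf X1 a) / 2) a0 ltac:(lra) ltac:(lra).
apply: le_trans (tail_nonincreasing demand2 _ _ a0 ax2).
by apply: le_trans le12; exact: tail_nonincreasing.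
Qed.

(** The cdfs are compared only on the open interval, since below [a] is a supremum of points where
    the opposite strict inequality holds; the left endpoint is a null set. *)
Lemma le_tail_diff a b : 0 <= a -> a <= b ->
  (forall u, a < u -> u < b -> rcdf X1 u <= rcdf X2 u) ->
  tail X2 a - tail X2 b <= tail X1 a - tail X1 b.
Proof.
move=> a0 ab le12; rewrite -lee_fin -!integral_survival//.
rewrite -!(integral_itv_obnd_cbnd (r:=a)); last 2 first.
- exact: measurable_survival.
- exact: measurable_survival.
apply: ge0_le_integral => //=.
- by move=> u _; rewrite lee_fin survival_ge0.
- exact: measurable_survival.
- exact: measurable_survival.
- move=> u; rewrite in_itv/= => /andP[au ub].
  by rewrite lee_fin lerD2l lerN2 le12.
Qed.

(* The difference of the tails increases wherever the cdf of [X1] is below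
   that of [X2], hence from the last point where it is above, if any. *)
Lemma ew_order_le_tail r : tail X1 0 = tail X2 0 -> 0 <= r ->
  tail X1 r <= tail X2 r.
Proof.
move=> means r0.
pose S := [set a | [/\ 0 <= a, a <= r & rcdf X2 a < rcdf X1 a]].
have [S0|S0] := pselect (S !=set0); last first.
  have := le_tail_diff 0 r (lexx _) r0; rewrite means => tr.
  suff : tail X2 0 - tail X2 r <= tail X2 0 - tail X1 r by lra.
  apply: tr => u u0 ur; rewrite leNgt; apply/negP => F21.
  by apply: S0; exists u; split => //; exact: ltW.
pose a := sup S.
have Sr : has_sup S by split => //; exists r => x [].
have a0 : 0 <= a.
  have [x Sx] := S0; have [x0 _ _] := Sx.
  by apply: le_trans x0 _; exact: sup_upper_bound.
have ar : a <= r by apply: ge_sup => // x [].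
(* As [a] need not belong to [S], it is approached by points [x] of [S]; [tail X2] is 1-Lipschitz,
   so the error is at most [a - x]. *)
have ta : tail X1 a <= tail X2 a.
  apply/ler_addgt0Pr => e e0.
  have [x Sx ax] := sup_adherent e0 Sr; have [x0 xr xF] := Sx.
  have xa : x <= a by exact: sup_upper_bound.
  apply: le_trans (tail_nonincreasing demand1 _ _ x0 xa) _.
  apply: le_trans (ew_order_le_tail_lt x x0 xF) _.
  apply: le_trans (tail_le demand2 _ _ x0 xa) _; rewrite lerD2l.
  have : (a - x) * survival X2 x <= a - x.
    by rewrite ler_piMr ?survival_le1// subr_ge0.
  by rewrite /a in ax *; lra.
suff : tail X2 a - tail X2 r <= tail X1 a - tail X1 r by lra.
apply: le_tail_diff => // u au ur; rewrite leNgt; apply/negP => F21.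
have : u <= a.
  apply: sup_upper_bound => //; split => //; last exact: ltW.
  exact: le_trans a0 (ltW au).
by rewrite leNgt au.
Qed.

Lemma ew_order_le_mrd r : tail X1 0 = tail X2 0 -> DMRD X1 \/ DMRD X2 ->
  0 <= r -> 0 < tail X1 r -> mrd X1 r <= mrd X2 r.
Proof.
move=> means dmrd r0 t1.
have t12 := ew_order_le_tail r means r0.
have S1 := survival_gt0 demand1 _ r0 t1.
have S2 := survival_gt0 demand2 _ r0 (lt_le_trans t1 t12).
have [F12|F21] := leP (rcdf X1 r) (rcdf X2 r).
  rewrite !mrdE// ler_pM//; [exact: tail_ge0|by rewrite invr_ge0 ltW|].
  by rewrite lef_pV2 ?posrE// lerD2l lerN2.
have quantile p := ew_order_tail_Finv r p r0.
case: dmrd => dmrd.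
- rewrite [leRHS]mrdE// ler_pdivlMr//.
  (* With [x1], [x2] the [p]-quantiles, [mrd X1 r * (1 - p) <= tail X1 x1 <= tail X2 x2 <= tail X2
     r]; then [p] tends to [rcdf X2 r]. *)
  apply: (le_convex_comb _ (mrd X1 r * survival X1 r)) => t t0 t1'.
  pose p := (1 - t) * rcdf X2 r + t * rcdf X1 r.
  have [||p0 p1 /andP[x1 x1r] rx2 le12] := quantile p; [rewrite /p; nra..|].
  have := dmrd _ _ x1 x1r; rewrite [leRHS]mrdE// survival_Finv//.
  rewrite ler_pdivlMr ?subr_gt0// => le1.
  have -> : (1 - t) * (mrd X1 r * survival X2 r) +
            t * (mrd X1 r * survival X1 r) = mrd X1 r * (1 - p).
    by rewrite /p /survival; ring.
  by rewrite (le_trans le1)// (le_trans le12)// tail_nonincreasing.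
- rewrite [leLHS]mrdE// ler_pdivrMr// -lerN2.
  (* Symmetrically [tail X1 r <= tail X1 x1 <= tail X2 x2 <= mrd X2 r * (1 - p)], with [p] tending
     to [rcdf X1 r]. The negation turns this lower bound into an upper one. *)
  apply: (le_convex_comb _ (- (mrd X2 r * survival X2 r))) => t t0 t1'.
  pose p := (1 - t) * rcdf X1 r + t * rcdf X2 r.
  have [||p0 p1 /andP[x1 x1r] rx2 le12] := quantile p; [rewrite /p; nra..|].
  have := dmrd _ _ r0 rx2; rewrite [leLHS]mrdE ?Finv_ge0// survival_Finv//.
  rewrite ler_pdivrMr ?subr_gt0// => le2.
  have -> : (1 - t) * - (mrd X2 r * survival X1 r) +
            t * - (mrd X2 r * survival X2 r) = - (mrd X2 r * (1 - p)).
    by rewrite /p /survival; ring.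
  rewrite lerN2 (le_trans _ le2)// (le_trans _ le12)//.
  exact: tail_nonincreasing.
Qed.

End comparison.

Theorem theorem4p6 (R : realType) (d1 d2 : measure_display)
  (T1 : measurableType d1) (T2 : measurableType d2)
  (P1 : probability T1 R) (P2 : probability T2 R)
  (X1 : {RV P1 >-> R}) (X2 : {RV P2 >-> R})
  (demand1 : nonneg_continuous_demand X1)
  (demand2 : nonneg_continuous_demand X2)
  (dgmrd1 : strictly_DGMRD X1) (dgmrd2 : strictly_DGMRD X2)
  (moment1 : finite_second_moment X1) (moment2 : finite_second_moment X2)
  (equal_means : 'E_P1[X1]%E = 'E_P2[X2]%E)
  (r1 r2 : R) (opt1 : optimal_price X1 r1) (opt2 : optimal_price X2 r2) :
  ((DMRD X1 \/ DMRD X2) -> ew_order X1 X2 ->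
     support_inf X1 <= support_inf X2 -> r1 <= r2) /\
  ((IFR X1 \/ IFR X2) -> disp_order X1 X2 -> r1 <= r2).
Proof.
have means : tail X1 0 = tail X2 0.
  by rewrite /tail -!expectation_tail_integral// equal_means.
suff main : DMRD X1 \/ DMRD X2 -> ew_order X1 X2 -> r1 <= r2.
  split=> [dmrd ew _|ifr disp]; first exact: main.
  apply: main; last exact: disp_ew_order.
  by case: ifr => ifr; [left|right]; exact: IFR_DMRD.
move=> dmrd ew; rewrite leNgt; apply/negP => r21.
have [r10 t1] := optimal_price_gt0 demand1 _ opt1.
have [r20 t2] := optimal_price_gt0 demand2 _ opt2.
have t12 : 0 < tail X2 r1.
  by rewrite (lt_le_trans t1)// ew_order_le_tail// ltW.
have := ew_order_le_mrd demand1 demand2 ew r1 means dmrd (ltW r10) t1.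
have : r1 <= mrd X1 r1.
  rewrite mrdE ?ler_pdivlMr//; [|by rewrite survival_gt0// ltW|exact: ltW].
  exact: optimal_price_le_mrd.
have : mrd X2 r2 <= r2.
  rewrite mrdE ?ler_pdivrMr//; [|by rewrite survival_gt0// ltW|exact: ltW].
  exact: optimal_price_ge_mrd.
(* Strict DGMRD compares only prices below the upper end of the support; the positive tail of [X2]
   at [r1] places [r1] there. *)
have r1H : (r1%:E < support_sup X2)%E.
  by rewrite lt_support_sup ?ltW// -subr_gt0; exact: survival_gt0 (ltW r10) t12.
have := dgmrd2 _ _ r20 r21 r1H.
rewrite ltr_pdivrMr// => lt12 le2 le1 le12.
have : mrd X2 r2 / r2 <= 1 by rewrite ler_pdivrMr// mul1r.
by nra.
Qed.
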